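(* Let $(X,r)$ be a multipermutation solution of the YBE of level $m$ (with $X$ of arbitrary cardinality). Then the structure group $G(X,r)$ is solvable of derived length at most $m+1$. Moreover, the monoid $A(X,r)$ is Malcev nilpotent of class at most $m+3$ and the group $A_{\mathrm{gr}}(X,r)$ is nilpotent of class at most $m+1$.
   Context: A solution of the YBE is a pair $(X,r)$ with $X$ a non-empty set and $r\colon X^2\to X^2$, $r(x,y)=(\lambda_x(y),\rho_y(x))$, a bijective map such that all $\lambda_x,\rho_y$ are bijective and $(r\times\mathrm{id})(\mathrm{id}\times r)(r\times\mathrm{id})=(\mathrm{id}\times r)(r\times\mathrm{id})(\mathrm{id}\times r)$ on $X^3$. Retract and multipermutation level: define $x\sim y$ iff $\lambda_x=\lambda_y$ and $\rho_x=\rho_y$. Then $r$ induces a solution $\overline r(\overline x,\overline y)=(\overline{\lambda_x(y)},\overline{\rho_y(x)})$ of the YBE on $\overline X=X/{\sim}$, denoted $\mathrm{Ret}(X,r)$. Put $\mathrm{Ret}^0(X,r)=(X,r)$ and $\mathrm{Ret}^n(X,r)=\mathrm{Ret}(\mathrm{Ret}^{n-1}(X,r))$. $(X,r)$ is a multipermutation solution of level $m$ if $m\geq 0$ is the smallest integer such that $\mathrm{Ret}^m(X,r)$ has exactly one element. $G(X,r)$ is the group generated by $X$ with relations $x\circ y=\lambda_x(y)\circ\rho_y(x)$ ($x,y\in X$). $A(X,r)$ is the monoid, and $A_{\mathrm{gr}}(X,r)$ the group, generated by $X$ with relations $x+\lambda_x(y)=\lambda_x(y)+\lambda_{\lambda_x(y)}(\rho_y(x))$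 ($x,y\in X$). Malcev nilpotency: for a semigroup $S$, $s,t\in S$ and $u_1,u_2,\dotsc\in S^1$ ($S^1$ is the smallest monoid containing $S$) put $x_0=s$, $y_0=t$, $x_{k+1}=x_ku_{k+1}y_k$, $y_{k+1}=y_ku_{k+1}x_k$. $S$ is Malcev nilpotent of class $k$ if $k\ge 0$ is the smallest integer such that $x_k=y_k$ for all $s,t\in S$ and all $u_1,\dotsc,u_k\in S^1$. *)

(* Defs.v *)
From HB Require Import structures.
From mathcomp Require Import all_boot.
From mathcomp Require Import boolp classical_sets.
From mathcomp Require Export monoid.

Set Implicit Arguments.
Unset Strict Implicit.
Unset Printing Implicit Defensive.

Local Open Scope group_scope.

Definition least (P : nat -> Prop) (n : nat) : Prop :=
  P n /\ forall k, P k -> (n <= k)%N.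

Section ClassicalQuotient.
Context {T : Type} (e : T -> T -> Prop).
Hypotheses (e_refl : forall x, e x x) (e_sym : forall x y, e x y -> e y x).
Hypothesis e_trans : forall x y z, e x y -> e y z -> e x z.

Definition asbool_rel : rel {classic T} := fun x y => `[< e x y >].

Lemma asbool_rel_refl : reflexive asbool_rel.
Proof. by move=> x; apply/asboolP. Qed.

Lemma asbool_rel_sym : symmetric asbool_rel.
Proof. by move=> x y; apply/asboolP/asboolP; apply: e_sym. Qed.

Lemma asbool_rel_trans : transitive asbool_rel.
Proof.
by move=> y x z /asboolP exy /asboolP eyz; apply/asboolP; apply: e_trans eyz.
Qed.

Definition classic_equiv : equiv_rel {classic T} :=
  EquivRel asbool_rel asbool_rel_refl asbool_rel_sym asbool_rel_trans.
End ClassicalQuotient.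

Local Open Scope quotient_scope.

Section Maps.
Context {X : Type} (r : X * X -> X * X).

Definition lam (x y : X) : X := (r (x, y)).1.
Definition rho (y x : X) : X := (r (x, y)).2.

Definition r_id (t : X * X * X) : X * X * X :=
  let: (x, y, z) := t in (r (x, y), z).
Definition id_r (t : X * X * X) : X * X * X :=
  let: (x, y, z) := t in (x, (r (y, z)).1, (r (y, z)).2).

Record is_solution : Prop := IsSolution {
  sol_inhabited : inhabited X;
  sol_bij : bijective r;
  sol_lam_bij : forall x, bijective (lam x);
  sol_rho_bij : forall y, bijective (rho y);
  sol_ybe : r_id \o id_r \o r_id =1 id_r \o r_id \o id_r
}.

Definition ret_eq (x y : X) : Prop := lam x = lam y /\ rho x = rho y.

Lemma ret_eq_refl x : ret_eq x x.
Proof. by []. Qed.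
Lemma ret_eq_sym x y : ret_eq x y -> ret_eq y x.
Proof. by case. Qed.
Lemma ret_eq_trans x y z : ret_eq x y -> ret_eq y z -> ret_eq x z.
Proof. by move=> [xy1 xy2] [yz1 yz2]; split; [rewrite xy1|rewrite xy2]. Qed.
End Maps.

Record solution : Type := Solution {
  carrier :> Type;
  sol_r : carrier * carrier -> carrier * carrier;
  solP : is_solution sol_r
}.

(* The map [r] induces a solution on the classes of [ret_eq]: [ret_eq] is
   compatible with [r] and with all the inverses involved.  Compatibility with
   the inverses is the delicate part when [X] is infinite; it follows from the
   fact that [r] and its inverse define the same relation [ret_eq]. *)
Section RetractCongruence.
Context {X : Type} {r : X * X -> X * X} (rP : is_solution r).
Local Notation lam := (lam r).
Local Notation rho := (rho r).

Lemma r_lam_rho x y : r (x, y) = (lam x y, rho y x).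
Proof. exact: surjective_pairing. Qed.

Lemma ybe3 x y z :
  [/\ lam (lam x y) (lam (rho y x) z) = lam x (lam y z),
      rho (lam (rho y x) z) (lam x y) = lam (rho (lam y z) x) (rho z y)
    & rho z (rho y x) = rho (rho z y) (rho (lam y z) x)].
Proof.
have := sol_ybe rP (x, y, z).
by rewrite /= !r_lam_rho /= !r_lam_rho => -[].
Qed.

Lemma lam_inj x : injective (lam x).
Proof. exact: bij_inj (sol_lam_bij rP x). Qed.
Lemma rho_inj x : injective (rho x).
Proof. exact: bij_inj (sol_rho_bij rP x). Qed.
Lemma lam_surj x z : exists y, lam x y = z.
Proof. by have [g _ gK] := sol_lam_bij rP x; exists (g z). Qed.
Lemma rho_surj x z : exists y, rho x y = z.
Proof. by have [g _ gK] := sol_rho_bij rP x; exists (g z). Qed.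

Lemma lam_lam x y : lam (lam x y) \o lam (rho y x) = lam x \o lam y.
Proof. by apply/funext => z; have [] := ybe3 x y z. Qed.

Lemma rho_rho x y : rho (rho y x) \o rho (lam x y) = rho y \o rho x.
Proof. by apply/funext => z; have [_ _ /=] := ybe3 z x y. Qed.

Lemma ret_eq_lam x y y' : ret_eq r y y' -> ret_eq r (lam x y) (lam x y').
Proof.
move=> [ly ry]; split; apply/funext => a.
  have [b <-] := lam_surj (rho y x) a.
  have /= -> := congr1 (@^~ b) (lam_lam x y).
  by rewrite ly ry; have /= <- := congr1 (@^~ b) (lam_lam x y').
apply: (@rho_inj (rho y x)); have /= -> := congr1 (@^~ a) (rho_rho x y).
by rewrite ry; have /= <- := congr1 (@^~ a) (rho_rho x y').
Qed.

Lemma ret_eq_rho y x x' : ret_eq r x x' -> ret_eq r (rho y x) (rho y x').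
Proof.
move=> [lx rx]; split; apply/funext => a; last first.
  have [b <-] := rho_surj (lam x y) a.
  have /= -> := congr1 (@^~ b) (rho_rho x y).
  by rewrite lx rx; have /= <- := congr1 (@^~ b) (rho_rho x' y).
apply: (@lam_inj (lam x y)); have /= -> := congr1 (@^~ a) (lam_lam x y).
by rewrite lx; have /= <- := congr1 (@^~ a) (lam_lam x' y).
Qed.

Lemma ret_eq_lam2 x x' y y' : ret_eq r x x' -> ret_eq r y y' ->
  ret_eq r (lam x y) (lam x' y').
Proof. by move=> [-> _]; apply: ret_eq_lam. Qed.

Lemma ret_eq_rho2 x x' y y' : ret_eq r x x' -> ret_eq r y y' ->
  ret_eq r (rho y x) (rho y' x').
Proof. by move=> + [_ ->]; apply: ret_eq_rho. Qed.
End RetractCongruence.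

Lemma inj_surj_bij T U (f : T -> U) :
  injective f -> (forall u, exists t, f t = u) -> bijective f.
Proof.
move=> f_inj f_surj; pose g u := projT1 (cid (f_surj u)).
have gK : cancel g f by move=> u; rewrite /g; case: cid.
by exists g => // t; apply: f_inj.
Qed.

Section InverseSolution.
Context {X : Type} {r s : X * X -> X * X} (rP : is_solution r).
Hypotheses (rK : cancel r s) (sK : cancel s r).

Lemma lam_rho_inv z w :
  lam r (lam s z w) (rho s w z) = z /\ rho r (rho s w z) (lam s z w) = w.
Proof. by have := sK (z, w); rewrite !r_lam_rho => -[]. Qed.

Lemma lam_inv_rho x y :
  lam s (lam r x y) (rho r y x) = x /\ rho s (rho r y x) (lam r x y) = y.
Proof. by have := rK (x, y); rewrite !r_lam_rho => -[]. Qed.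

Lemma inverse_solution : is_solution s.
Proof.
split; first exact: sol_inhabited rP.
- by exists r.
- move=> z; apply: inj_surj_bij => [w w' eqx|x]; last first.
    have [y <-] := lam_surj rP x z; exists (rho r y x).
    by have [] := lam_inv_rho x y.
  have [zE wE] := lam_rho_inv z w; have [zE' wE'] := lam_rho_inv z w'.
  rewrite -eqx in zE' wE'; rewrite -wE -wE'; congr (rho r _ _).
  by apply: (lam_inj rP (x := lam s z w)); rewrite zE zE'.
- move=> w; apply: inj_surj_bij => [z z' eqy|y]; last first.
    have [x <-] := rho_surj rP y w; exists (lam r x y).
    by have [] := lam_inv_rho x y.
  have [zE wE] := lam_rho_inv z w; have [zE' wE'] := lam_rho_inv z' w.
  rewrite -eqy in zE' wE'; rewrite -zE -zE'; congr (lam r _ _).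
  by apply: (rho_inj rP (x := rho s w z)); rewrite wE wE'.
have r1K : cancel (r_id s) (r_id r).
  by move=> [[x y] z] /=; case E: (s _) => [a b] /=; rewrite -E sK.
have r2K : cancel (id_r s) (id_r r).
  by move=> [[x y] z] /=; rewrite -surjective_pairing sK.
have r1I : injective (r_id r).
  by move=> [[x y] z] [[x' y'] z'] /= [/(can_inj rK)[-> ->] ->].
have r2I : injective (id_r r).
  move=> [[x y] z] [[x' y'] z'] /= [-> e1 e2].
  suff /(can_inj rK)[-> ->] : r (y, z) = r (y', z') by [].
  by rewrite [LHS]surjective_pairing e1 e2 -surjective_pairing.
have ybeK t : r_id r (id_r r (r_id r (id_r s (r_id s (id_r s t))))) = t.
  by rewrite -[LHS]/((r_id r \o id_r r \o r_id r) _) (sol_ybe rP) /comp r2K r1K r2K.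
move=> t; apply: (r1I); apply: r2I; apply: (r1I).
by rewrite [RHS]ybeK [(_ \o _) t]/comp r1K r2K r1K.
Qed.

Lemma lam_lam_inv x y t :
  lam s x (lam s y t) = lam s (lam r x y) (lam s (rho r y x) t).
Proof.
have := lam_lam inverse_solution (lam r x y) (rho r y x).
by have [-> ->] := lam_inv_rho x y; move=> /(congr1 (@^~ t)).
Qed.

Lemma rho_rho_inv x y t :
  rho s y (rho s x t) = rho s (rho r y x) (rho s (lam r x y) t).
Proof.
have := rho_rho inverse_solution (lam r x y) (rho r y x).
by have [-> ->] := lam_inv_rho x y; move=> /(congr1 (@^~ t)).
Qed.

Lemma ret_eq_inv z z' : ret_eq r z z' -> ret_eq s z z'.
Proof.
move=> zz'; have sP := inverse_solution; split; apply/funext => v.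
  have [t tv] := lam_surj sP v v.
  have [e ev] := rho_surj rP (rho r v z) v.
  have ev' : rho r (rho r v z') e = v by have [_ <-] := ret_eq_rho rP v zz'.
  have K p : rho r p e = v -> lam s e (lam s p t) = e.
    move=> epv; rewrite lam_lam_inv epv tv -epv.
    by have [] := lam_inv_rho e p.
  rewrite -tv (lam_lam_inv z) (lam_lam_inv z').
  have [<- _] := zz'; congr (lam s _ _).
  by apply: (lam_inj sP (x := e)); rewrite !K.
have [t tv] := rho_surj sP v v.
have [e ev] := lam_surj rP (lam r v z) v.
have ev' : lam r (lam r v z') e = v by have [<- _] := ret_eq_lam rP v zz'.
have K p : lam r p e = v -> rho s e (rho s p t) = e.
  move=> epv; rewrite rho_rho_inv epv tv -epv.
  by have [] := lam_inv_rho p e.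
rewrite -tv (rho_rho_inv v z) (rho_rho_inv v z').
have [_ <-] := zz'; congr (rho s _ _).
by apply: (rho_inj sP (x := e)); rewrite !K.
Qed.
End InverseSolution.

Section RetractInverse.
Context {X : Type} {r : X * X -> X * X} (rP : is_solution r).

Lemma ret_eq_r_inj x x' y y' :
    ret_eq r (lam r x y) (lam r x' y') -> ret_eq r (rho r y x) (rho r y' x') ->
  ret_eq r x x' /\ ret_eq r y y'.
Proof.
have [s rK sK] := sol_bij rP; have sP := inverse_solution rP rK sK.
move=> /(ret_eq_inv rP rK sK) e1 /(ret_eq_inv rP rK sK) e2.
have := ret_eq_lam2 sP e1 e2; have := ret_eq_rho2 sP e1 e2.
have [-> ->] := lam_inv_rho rK x y; have [-> ->] := lam_inv_rho rK x' y'.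
by split; apply: (ret_eq_inv sP sK rK).
Qed.

Lemma ret_eq_lam_inj x y y' : ret_eq r (lam r x y) (lam r x y') -> ret_eq r y y'.
Proof.
have [s rK sK] := sol_bij rP => e.
have [l _] := ret_eq_inv rP rK sK e.
suff w : rho r y x = rho r y' x.
  by apply: (proj2 (ret_eq_r_inj e _)); rewrite w; apply: ret_eq_refl.
apply: (lam_inj (inverse_solution rP rK sK) (x := lam r x y)).
have [-> _] := lam_inv_rho rK x y; rewrite l.
by have [-> _] := lam_inv_rho rK x y'.
Qed.

Lemma ret_eq_rho_inj y x x' : ret_eq r (rho r y x) (rho r y x') -> ret_eq r x x'.
Proof.
have [s rK sK] := sol_bij rP => e.
have [_ l] := ret_eq_inv rP rK sK e.
suff w : lam r x y = lam r x' y.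
  by apply: (proj1 (ret_eq_r_inj _ e)); rewrite w; apply: ret_eq_refl.
apply: (rho_inj (inverse_solution rP rK sK) (x := rho r y x)).
have [_ ->] := lam_inv_rho rK x y; rewrite l.
by have [_ ->] := lam_inv_rho rK x' y.
Qed.
End RetractInverse.

Section Retract.
Context (S : solution).
Local Notation r := (@sol_r S).

Definition ret_equiv : equiv_rel {classic S} :=
  classic_equiv (@ret_eq_refl _ r) (@ret_eq_sym _ r) (@ret_eq_trans _ r).

Definition ret_carrier : Type := {eq_quot ret_equiv}.
Definition ret_class (x : S) : ret_carrier := \pi_{eq_quot ret_equiv} x.
Definition ret_repr (a : ret_carrier) : S := repr (a : {eq_quot ret_equiv}).

Lemma ret_classP x y : ret_class x = ret_class y <-> ret_eq r x y.
Proof. by split=> [/eqmodP/asboolP//|xy]; apply/eqmodP/asboolP. Qed.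

Lemma ret_reprK : cancel ret_repr ret_class.
Proof. exact: reprK. Qed.

Definition ret_r (p : ret_carrier * ret_carrier) : ret_carrier * ret_carrier :=
  let x := ret_repr p.1 in let y := ret_repr p.2 in
  (ret_class (lam r x y), ret_class (rho r y x)).

Lemma ret_rE x y :
  ret_r (ret_class x, ret_class y) =
  (ret_class (lam r x y), ret_class (rho r y x)).
Proof.
have ex a : ret_eq r (ret_repr (ret_class a)) a by apply/ret_classP/ret_reprK.
rewrite /ret_r /=; congr pair; apply/ret_classP.
  exact (ret_eq_lam2 (solP S) (ex x) (ex y)).
exact (ret_eq_rho2 (solP S) (ex x) (ex y)).
Qed.

Lemma ret_ind (P : ret_carrier -> Prop) :
  (forall x, P (ret_class x)) -> forall a, P a.
Proof. by move=> H a; rewrite -[a]ret_reprK. Qed.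

Lemma ret_solution : is_solution ret_r.
Proof.
have lE x y : lam ret_r (ret_class x) (ret_class y) = ret_class (lam r x y).
  by rewrite /lam ret_rE.
have rE x y : rho ret_r (ret_class y) (ret_class x) = ret_class (rho r y x).
  by rewrite /rho ret_rE.
split.
- by have [x] := sol_inhabited (solP S); split; apply: ret_class.
- apply: inj_surj_bij => [[a b] [c d]|[a b]].
    elim/ret_ind: a => x; elim/ret_ind: b => y.
    elim/ret_ind: c => x'; elim/ret_ind: d => y'.
    rewrite !ret_rE => -[/ret_classP e1 /ret_classP e2].
    by have [/ret_classP -> /ret_classP ->] := ret_eq_r_inj (solP S) e1 e2.
  elim/ret_ind: a => x; elim/ret_ind: b => y.
  have [s _ sK] := sol_bij (solP S).
  exists (ret_class (s (x, y)).1, ret_class (s (x, y)).2).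
  by rewrite ret_rE /lam /rho -surjective_pairing sK.
- elim/ret_ind=> x; apply: inj_surj_bij => [a b|a].
    elim/ret_ind: a => y; elim/ret_ind: b => y'.
    rewrite !lE => /ret_classP e.
    exact/ret_classP/(ret_eq_lam_inj (solP S) e).
  elim/ret_ind: a => y; have [z <-] := lam_surj (solP S) x y.
  by exists (ret_class z).
- elim/ret_ind=> x; apply: inj_surj_bij => [a b|a].
    elim/ret_ind: a => y; elim/ret_ind: b => y'.
    rewrite !rE => /ret_classP e.
    exact/ret_classP/(ret_eq_rho_inj (solP S) e).
  elim/ret_ind: a => y; have [z <-] := rho_surj (solP S) x y.
  by exists (ret_class z).
have r1E x y z : r_id ret_r (ret_class x, ret_class y, ret_class z) =
    (ret_class (lam r x y), ret_class (rho r y x), ret_class z).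
  by rewrite /r_id ret_rE.
have r2E x y z : id_r ret_r (ret_class x, ret_class y, ret_class z) =
    (ret_class x, ret_class (lam r y z), ret_class (rho r z y)).
  by rewrite /id_r ret_rE.
move=> [[a b] c]; elim/ret_ind: a => x; elim/ret_ind: b => y.
elim/ret_ind: c => z; rewrite /comp !(r1E, r2E).
by have [-> -> ->] := ybe3 (solP S) x y z.
Qed.

Definition Ret : solution := Solution ret_solution.
End Retract.

Definition multipermutation_level (S : solution) (m : nat) : Prop :=
  least (fun n => exists x : iter n Ret S, forall y, y = x) m.

(* Words over [T] modulo the congruence generated by [R]. *)
Section MonoidPresentation.
Context {T : Type} (R : seq T -> seq T -> Prop).

Inductive word_eq : seq T -> seq T -> Prop :=
| word_eq_rel u a b v : R a b -> word_eq (u ++ a ++ v) (u ++ b ++ v)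
| word_eq_refl a : word_eq a a
| word_eq_sym a b : word_eq a b -> word_eq b a
| word_eq_trans a b c : word_eq a b -> word_eq b c -> word_eq a c.

Definition word_equiv : equiv_rel {classic (seq T)} :=
  classic_equiv word_eq_refl word_eq_sym word_eq_trans.

Definition pres_monoid : Type := {eq_quot word_equiv}.
HB.instance Definition _ := Choice.on pres_monoid.

Definition pres_class (w : seq T) : pres_monoid := \pi_{eq_quot word_equiv} w.
Definition pres_repr (a : pres_monoid) : seq T :=
  repr (a : {eq_quot word_equiv}).

Lemma pres_classP u v : pres_class u = pres_class v <-> word_eq u v.
Proof. by split=> [/eqmodP/asboolP//|uv]; apply/eqmodP/asboolP. Qed.

Lemma pres_reprK : cancel pres_repr pres_class.
Proof. exact: reprK. Qed.

Lemma pres_ind (P : pres_monoid -> Prop) :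
  (forall w, P (pres_class w)) -> forall a, P a.
Proof. by move=> H a; rewrite -[a]pres_reprK. Qed.

Lemma word_eq_cat2l u a b : word_eq a b -> word_eq (u ++ a) (u ++ b).
Proof.
elim=> [w c d v Rcd|c|c d _|c d e _ + _]; first 1 last.
- exact: word_eq_refl.
- exact: word_eq_sym.
- exact: word_eq_trans.
by rewrite !(catA u w); apply: word_eq_rel.
Qed.

Lemma word_eq_cat2r u a b : word_eq a b -> word_eq (a ++ u) (b ++ u).
Proof.
elim=> [w c d v Rcd|c|c d _|c d e _ + _]; first 1 last.
- exact: word_eq_refl.
- exact: word_eq_sym.
- exact: word_eq_trans.
by rewrite -!catA; apply: word_eq_rel.
Qed.

Lemma word_eq_cat a b c d :
  word_eq a b -> word_eq c d -> word_eq (a ++ c) (b ++ d).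
Proof.
by move=> /(word_eq_cat2r c) + /(word_eq_cat2l b); apply: word_eq_trans.
Qed.

Definition pres_mul (a b : pres_monoid) : pres_monoid :=
  pres_class (pres_repr a ++ pres_repr b).
Definition pres_one : pres_monoid := pres_class [::].

Lemma pres_mulE u v : pres_mul (pres_class u) (pres_class v) = pres_class (u ++ v).
Proof.
by apply/pres_classP/word_eq_cat; apply/pres_classP/pres_reprK.
Qed.

Lemma pres_mulA : associative pres_mul.
Proof.
elim/pres_ind=> u; elim/pres_ind=> v; elim/pres_ind=> w.
by rewrite !pres_mulE catA.
Qed.

Lemma pres_mul1g : left_id pres_one pres_mul.
Proof. by elim/pres_ind=> u; rewrite pres_mulE. Qed.

Lemma pres_mulg1 : right_id pres_one pres_mul.
Proof. by elim/pres_ind=> u; rewrite pres_mulE cats0. Qed.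

HB.instance Definition _ := isMonoid.Build pres_monoid
  pres_mulA pres_mul1g pres_mulg1.
End MonoidPresentation.

(* The letter [(x, true)] stands for [x] and [(x, false)] for its inverse. *)
Section GroupPresentation.
Context {T : Type} (R : seq T -> seq T -> Prop).

Definition pos_word (w : seq T) : seq (T * bool) := [seq (x, true) | x <- w].

Inductive group_rel : seq (T * bool) -> seq (T * bool) -> Prop :=
| group_rel_pos u v : R u v -> group_rel (pos_word u) (pos_word v)
| group_rel_cancel x b : group_rel [:: (x, b); (x, ~~ b)] [::].

Definition pres_group : Type := pres_monoid group_rel.
HB.instance Definition _ := Monoid.on pres_group.

Definition inv_word (w : seq (T * bool)) : seq (T * bool) :=
  rev [seq (p.1, ~~ p.2) | p <- w].

Definition pres_inv (a : pres_group) : pres_group :=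
  pres_class group_rel (inv_word (pres_repr a)).

Lemma inv_wordK : involutive inv_word.
Proof.
elim=> [|[x b] w IH] //; move: IH; rewrite /inv_word !map_rev !revK /=.
by rewrite negbK => ->.
Qed.

Lemma word_mulgV w : word_eq group_rel (w ++ inv_word w) [::].
Proof.
elim: w => [|[x b] w IH]; first exact: word_eq_refl.
rewrite /inv_word map_cons rev_cons /= -cats1.
have /= := word_eq_cat2l [:: (x, b)] (word_eq_cat2r [:: (x, ~~ b)] IH).
rewrite -catA => /word_eq_trans; apply.
exact: (word_eq_rel [::] [::] (group_rel_cancel x b)).
Qed.

Lemma word_mulVg w : word_eq group_rel (inv_word w ++ w) [::].
Proof. by have := word_mulgV (inv_word w); rewrite inv_wordK. Qed.

Lemma pres_mulVg : left_inverse (@one pres_group) pres_inv mul.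
Proof.
move=> a; rewrite -[X in mul _ X]pres_reprK [LHS]pres_mulE.
exact/pres_classP/word_mulVg.
Qed.

Lemma pres_mulgV : right_inverse (@one pres_group) pres_inv mul.
Proof.
move=> a; rewrite -[X in mul X]pres_reprK [LHS]pres_mulE.
exact/pres_classP/word_mulgV.
Qed.

HB.instance Definition _ := hasInv.Build pres_group pres_inv.
HB.instance Definition _ :=
  Monoid_isGroup.Build pres_group pres_mulVg pres_mulgV.
End GroupPresentation.

Section StructureGroups.
Context (S : solution).
Local Notation lam := (lam (@sol_r S)).
Local Notation rho := (rho (@sol_r S)).

Inductive structure_rel : seq S -> seq S -> Prop :=
| StructureRel x y : structure_rel [:: x; y] [:: lam x y; rho y x].

(* The operation written additively in [x + lam x y = ...] is here the
   multiplication of a [monoidType]; it is not commutative. *)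
Inductive derived_rel : seq S -> seq S -> Prop :=
| DerivedRel x y : derived_rel [:: x; lam x y]
    [:: lam x y; lam (lam x y) (rho y x)].

Definition structure_group : groupType := pres_group structure_rel.
Definition derived_monoid : monoidType := pres_monoid derived_rel.
Definition derived_group : groupType := pres_group derived_rel.
End StructureGroups.

Local Open Scope classical_set_scope.

Section Series.
Context (G : groupType).

Definition is_subgroup (H : set G) : Prop :=
  [/\ H 1, forall x y, H x -> H y -> H (x * y) & forall x, H x -> H x^-1].

Definition comm_subgroup (H K : set G) : set G :=
  smallest is_subgroup [set [~ x, y] | x in H & y in K].

Definition derived_series (n : nat) : set G :=
  iter n (fun H => comm_subgroup H H) setT.

Definition lower_central_series (n : nat) : set G :=
  iter n (fun H => comm_subgroup H setT) setT.

Definition solvable_of_length (d : nat) : Prop :=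
  least (fun n => derived_series n = [set 1]) d.

Definition nilpotent_of_class (c : nat) : Prop :=
  least (fun n => lower_central_series n = [set 1]) c.
End Series.

Section Malcev.
Context (S : monoidType).

(* [S] already has a unit, so the smallest monoid containing it is [S] itself
   and the parameters [u 1], [u 2], ... range over [S]. *)
Fixpoint malcev_pair (u : nat -> S) (s t : S) (k : nat) : S * S :=
  if k is k'.+1 then
    let: (x, y) := malcev_pair u s t k' in (x * u k * y, y * u k * x)
  else (s, t).

Definition malcev_nilpotent_of_class (c : nat) : Prop :=
  least (fun k => forall (s t : S) (u : nat -> S),
    (malcev_pair u s t k).1 = (malcev_pair u s t k).2) c.
End Malcev.

(* Main.v *)
(* Writing [sig z x] for the element with x + z = z + sig z x, the map [sig] is
   a rack operation on X, and equivalent elements (same [lam] and [rho]) have the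
   same [sig].  For both groups one argues by induction along the retracts, using
   the epimorphism onto the group of Ret(X, r), whose kernel is the normal
   closure of the quotients x y^-1 with x ~ y.
   - In A_gr, conjugation by z acts on generators as [sig z], so x y^-1 is
     central and the kernel is central.
   - In G, conjugation permutes the set D of quotients x y^-1 with x ~ y, and
     z d z^-1 (d in D) depends on z only through [lam z]; so the elements of D
     commute with each other and the kernel is abelian.
   - In a group of nilpotency class c the Malcev words x_c and y_c agree.  Hence,
     for c = m + 1, x_c and y_c in A(X, r) act by the same bijection s of X.  From
     there two more steps suffice: x u y = x y s(u) and y u x = y x s(u) reduce
     the claim to x y y x = y x x y, and both sides equal x x y y because
     x x = s(x) s(x) and y y = s(y) s(y). *)
Require Import Defs.
From mathcomp Require Import all_boot.
From mathcomp Require Import boolp classical_sets.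

Set Implicit Arguments.
Unset Strict Implicit.
Unset Printing Implicit Defensive.

Local Open Scope classical_set_scope.
Local Open Scope group_scope.

Lemma least_le (P : nat -> Prop) n : P n -> exists2 d, least P d & d <= n.
Proof.
move=> Pn; have exP : exists k, `[< P k >] by exists n; apply/asboolP.
case: (ex_minnP exP) => d /asboolP Pd dmin; exists d; last exact/dmin/asboolP.
by split=> // k Pk; apply/dmin/asboolP.
Qed.

(** * Centralizers and commutator subgroups *)

Section Subgroups.
Context {G : groupType}.

Definition is_normal (N : set G) : Prop :=
  is_subgroup N /\ forall x g, N x -> N (x ^ g).

Definition centralizer (A : set G) : set G := [set g | forall a, A a -> commute g a].

Lemma centralizer_subgroup A : is_subgroup (centralizer A).
Proof.
split=> [a _|x y xA yA a Aa|x xA a Aa]; apply: commute_sym.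
- exact: commute1.
- by apply: commuteM; apply: commute_sym; [apply: xA|apply: yA].
- by apply: commuteV; apply: commute_sym; apply: xA.
Qed.

(** These are the normal subgroups to which [pres_map_kernel] is applied below. To commute with [a],
    conjugate back to [a ^ g^-1], which again lies in [A]. *)
Lemma centralizer_normal A :
  (forall a g, A a -> A (a ^ g)) -> is_normal (centralizer A).
Proof.
move=> AJ; split=> [|x g xA a Aa]; first exact: centralizer_subgroup.
by rewrite -[a](conjgKV g) /commute -!conjMg (xA _ (AJ a g^-1 Aa)).
Qed.

Lemma conj_div (x y z a b c : G) :
  z * x = a * c -> z * y = b * c -> (x / y) ^ z^-1 = a / b.
Proof.
move=> zx zy; have -> : x = z^-1 * (a * c) by rewrite -zx mulKg.
have -> : y = z^-1 * (b * c) by rewrite -zy mulKg.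
by rewrite /conjg !invgM !invgK !mulgA mulgV mul1g !mulgK.
Qed.

Lemma conjV_eq_commute (d z w : G) : d ^ z^-1 = d ^ w^-1 -> commute (w^-1 * z) d.
Proof.
move=> zw; apply: commute_sym; have -> : w^-1 * z = (z^-1 * w)^-1.
  by rewrite invgM invgK.
by apply/commuteV/commgP; rewrite -conjg_fix conjgM zw conjgKV.
Qed.

Lemma is_subgroup1 : is_subgroup [set 1 : G].
Proof.
by split=> // [x y -> ->|x ->]; rewrite ?mulg1 ?invg1.
Qed.

Lemma comm_subgroup_is_subgroup (A B : set G) : is_subgroup (comm_subgroup A B).
Proof.
split=> [H [[] //]|x y Hx Hy H HP|x Hx H HP]; have [[_ HM HV] _] := HP.
- by apply: HM; [apply: Hx|apply: Hy].
- by apply: HV; apply: Hx.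
Qed.

Lemma comm_subgroup_mem (A B : set G) x y : A x -> B y -> comm_subgroup A B [~ x, y].
Proof. by move=> Ax By; apply: sub_gen_smallest; exists x => //; exists y. Qed.

Lemma comm_subgroup_triv (A B : set G) :
  (forall x y, A x -> B y -> commute x y) -> comm_subgroup A B = [set 1].
Proof.
move=> AB; apply/seteqP; split; last first.
  by move=> _ ->; have [] := comm_subgroup_is_subgroup A B.
apply: smallest_sub; first exact: is_subgroup1.
by move=> _ [x Ax [y By <-]]; apply/eqP/commgP/AB.
Qed.

Lemma lower_central_series_is_subgroup n : is_subgroup (@lower_central_series G n).
Proof. by case: n => [|n]; [split|apply: comm_subgroup_is_subgroup]. Qed.
End Subgroups.

(** * Derived and lower central series under morphisms *)

Section Morphisms.
Context {G H : groupType} (f : G -> H) (fM : {morph f : x y / x * y}).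

Lemma morph_one : f 1 = 1.
Proof. by apply: (@mulgI _ (f 1)); rewrite -fM !mulg1. Qed.

Lemma morph_inv x : f x^-1 = (f x)^-1.
Proof. by apply: (@mulgI _ (f x)); rewrite -fM !mulgV morph_one. Qed.

Lemma morph_comm_subgroup (A B : set G) (A' B' : set H) :
    (forall x, A x -> A' (f x)) -> (forall x, B x -> B' (f x)) ->
  forall x, comm_subgroup A B x -> comm_subgroup A' B' (f x).
Proof.
move=> AA' BB'; have [s1 sM sV] := comm_subgroup_is_subgroup A' B'.
apply: (@smallest_sub _ _ _ [set x | comm_subgroup A' B' (f x)]).
  split=> [|x y /= sx sy|x /= sx] /=.
  - by rewrite morph_one.
  - by rewrite fM; apply: sM.
  - by rewrite morph_inv; apply: sV.
move=> _ [x Ax [y By <-]] /=.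
by rewrite /commg /conjg !(fM, morph_inv); apply: comm_subgroup_mem; auto.
Qed.

(** The [n]-th derived term of [G] lands in the kernel of [f], so its elements commute and the next
    term is trivial. *)
Lemma derived_series_abelian_kernel n :
    (forall x y, f x = 1 -> f y = 1 -> commute x y) ->
  @derived_series H n = [set 1] -> @derived_series G n.+1 = [set 1].
Proof.
move=> ker_ab Hn; apply: comm_subgroup_triv.
have sub k x : @derived_series G k x -> @derived_series H k (f x).
  by elim: k x => //= k IH; apply: morph_comm_subgroup.
by move=> x y /sub + /sub; rewrite Hn; apply: ker_ab.
Qed.

Lemma lower_central_series_central_kernel n :
    (forall x y, f x = 1 -> commute x y) ->
  @lower_central_series H n = [set 1] -> @lower_central_series G n.+1 = [set 1].
Proof.
move=> ker_c Hn; apply: comm_subgroup_triv.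
have sub k x : @lower_central_series G k x -> @lower_central_series H k (f x).
  by elim: k x => //= k IH; apply: morph_comm_subgroup.
by move=> x y /sub; rewrite Hn => /= fx1 _; apply: ker_c.
Qed.
End Morphisms.

(** * Groups given by generators and relations *)

Section PresentedGroup.
Context {T : Type} (R : seq T -> seq T -> Prop).
Local Notation G := (pres_group R).

Definition ev (w : seq (T * bool)) : G := pres_class (group_rel R) w.
Definition gen (x : T) : G := ev [:: (x, true)].

Lemma ev_cat u v : ev (u ++ v) = ev u * ev v.
Proof. by symmetry; apply: pres_mulE. Qed.

Lemma ev_cons x b w : ev ((x, b) :: w) = (if b then gen x else (gen x)^-1) * ev w.
Proof.
rewrite -cat1s ev_cat; case: b => //; congr (_ * _).
apply: (@mulgI _ (gen x)); rewrite mulgV -ev_cat; apply/pres_classP.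
exact: (word_eq_rel [::] [::] (group_rel_cancel R x true)).
Qed.

Lemma ev_nil : ev [::] = 1.
Proof. by []. Qed.

Lemma ev_ind (P : G -> Prop) : (forall w, P (ev w)) -> forall g, P g.
Proof. exact: pres_ind. Qed.

Lemma ev_rel u v : R u v -> ev (pos_word u) = ev (pos_word v).
Proof.
move=> Ruv; apply/pres_classP.
by have := word_eq_rel [::] [::] (group_rel_pos Ruv); rewrite /= !cats0.
Qed.

Lemma gen_rel2 x y z t : R [:: x; y] [:: z; t] -> gen x * gen y = gen z * gen t.
Proof. by move=> /ev_rel; rewrite /= !ev_cons !ev_nil !mulg1. Qed.

Lemma subgroup_gen (H : set G) :
  is_subgroup H -> (forall x, H (gen x)) -> forall g, H g.
Proof.
move=> [H1 HM HV] Hgen g; elim/ev_ind: g => w; elim: w => [|[x b] w IH] //.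
by rewrite ev_cons; apply: HM => //; case: b => //; apply: HV.
Qed.

Lemma commute_gen (a : G) :
  (forall x, commute a (gen x)) -> forall g, commute a g.
Proof.
move=> a_gen g; apply: commute_sym.
have cP x : centralizer [set a] (gen x) by move=> _ ->; apply: commute_sym.
exact: (subgroup_gen (centralizer_subgroup [set a]) cP g).
Qed.

(** Both signs are required: a conjugation may map an infinite [D] into itself without being
    onto. *)
Lemma gen_conj_closed (D : set G) :
    (forall d x, D d -> D (d ^ gen x)) -> (forall d x, D d -> D (d ^ (gen x)^-1)) ->
  forall d g, D d -> D (d ^ g).
Proof.
move=> DJ DJV d g; elim/ev_ind: g => w; elim: w => [|[x b] w IH] in d *.
  by rewrite ev_nil conjg1.
by rewrite ev_cons conjgM => Dd; apply: IH; case: b; auto.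
Qed.
End PresentedGroup.

(** * Induced maps of presented groups and their kernels *)

Section PresentedMorphism.
Context {T U : Type} (R : seq T -> seq T -> Prop) (Q : seq U -> seq U -> Prop).
Context (p : T -> U).
Hypothesis p_rel : forall u v, R u v -> Q (map p u) (map p v).
Local Notation G := (pres_group R).
Local Notation H := (pres_group Q).

Definition map_word (w : seq (T * bool)) := [seq (p a.1, a.2) | a <- w].

Lemma map_word_pos w : map_word (pos_word w) = pos_word (map p w).
Proof. by rewrite /map_word /pos_word -!map_comp. Qed.

Lemma word_eq_map u v : word_eq (group_rel R) u v ->
  word_eq (group_rel Q) (map_word u) (map_word v).
Proof.
elim=> [a c d b|a|a c _|a c d _ + _]; first 1 last.
- exact: word_eq_refl.
- exact: word_eq_sym.
- exact: word_eq_trans.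
rewrite /map_word !map_cat -!/(map_word _) => Rcd; apply: word_eq_rel.
case: Rcd => [e f Ref|x e]; last exact: group_rel_cancel.
by rewrite !map_word_pos; apply: group_rel_pos; apply: p_rel.
Qed.

Definition pres_map (g : G) : H := ev Q (map_word (pres_repr g)).

Lemma pres_map_ev w : pres_map (ev R w) = ev Q (map_word w).
Proof. by apply/pres_classP/word_eq_map/pres_classP/pres_reprK. Qed.

Lemma pres_mapM : {morph pres_map : x y / x * y}.
Proof.
move=> x y; elim/(@ev_ind _ R): x => u; elim/(@ev_ind _ R): y => v.
by rewrite -ev_cat !pres_map_ev -ev_cat /map_word map_cat.
Qed.

Context (sec : U -> T) (secK : cancel sec p).
Hypothesis rel_lift : forall u v, Q u v ->
  exists u0 v0, [/\ R u0 v0, map p u0 = u & map p v0 = v].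
Context (N : set G) (N_normal : is_normal N).
Hypothesis N_fiber : forall x y, p x = p y -> N (gen R x * (gen R y)^-1).

Local Notation cong g h := (N (g * h^-1)).

Let N1 : N 1. Proof. by have [[]] := N_normal. Qed.
Let NM x y : N x -> N y -> N (x * y).
Proof. by have [[_ + _] _] := N_normal; apply. Qed.
Let NV x : N x -> N x^-1. Proof. by have [[_ _ +] _] := N_normal; apply. Qed.
Let NJ x g : N x -> N (x ^ g). Proof. by have [_] := N_normal; apply. Qed.

Let cong_refl g : cong g g. Proof. by rewrite mulgV. Qed.
Let cong_sym g h : cong g h -> cong h g.
Proof. by move=> /NV; rewrite invgM invgK. Qed.
Let cong_trans g h k : cong g h -> cong h k -> cong g k.
Proof. by move=> gh /(NM gh); rewrite mulgA mulgVK. Qed.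
Let cong_mul g h g' h' : cong g h -> cong g' h' -> cong (g * g') (h * h').
Proof.
move=> gh /(NJ g^-1) gh'; have := NM gh' gh.
by rewrite /conjg invgK invgM !mulgA mulgVK.
Qed.
Let cong_inv g h : cong g h -> cong g^-1 h^-1.
Proof.
by move=> /cong_sym /(NJ h); rewrite /conjg -!mulgA mulKg invgK.
Qed.

Lemma cong_map_word u v : map_word u = map_word v -> cong (ev R u) (ev R v).
Proof.
elim: u v => [|[x b] u IH] [|[y c] v] //= [pxy <- /IH uv].
rewrite !ev_cons; apply: cong_mul => //.
by case: b; [|apply: cong_inv]; apply: N_fiber.
Qed.

(** Induction on the derivation. The claim ranges over all lifts, so for transitivity the middle
    word can be lifted through [sec] and both hypotheses applied to that lift. *)
Lemma cong_word_eq u v : word_eq (group_rel Q) u v ->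
  forall u0 v0, map_word u0 = u -> map_word v0 = v -> cong (ev R u0) (ev R v0).
Proof.
pose lift (w : seq (U * bool)) := [seq (sec a.1, a.2) | a <- w].
have liftK w : map_word (lift w) = w.
  by rewrite /map_word -map_comp -[RHS]map_id; apply: eq_map => -[x b] /=; rewrite secK.
elim=> [a c d b Rcd|a|a c _ IH|a c d _ IH _ IH'] u0 v0; first last.
- by move=> ua vd; apply: (@cong_trans _ (ev R (lift c))); [apply: IH|apply: IH'].
- by move=> uc va; apply/cong_sym/IH.
- by move=> ua va; apply: cong_map_word; rewrite ua va.
move=> uE vE.
have [c0 [d0 [c0E d0E cd]]] : exists c0 d0,
    [/\ map_word c0 = c, map_word d0 = d & ev R c0 = ev R d0].
  case: Rcd => [e f /rel_lift[e0 [f0 [ef <- <-]]]|x e].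
    exists (pos_word e0), (pos_word f0); rewrite !map_word_pos.
    by split=> //; apply: ev_rel.
  exists [:: (sec x, e); (sec x, ~~ e)], [::]; rewrite /= secK; split=> //.
  apply/pres_classP.
  exact: (word_eq_rel [::] [::] (group_rel_cancel R (sec x) e)).
(* Modulo [N] the choice of lift is irrelevant, so [c] and [d] may be lifted to [c0] and [d0], which
   are equal in the source group. *)
have {}uE : cong (ev R u0) (ev R (lift a ++ c0 ++ lift b)).
  by apply: cong_map_word; rewrite uE /map_word !map_cat -!/(map_word _) !liftK c0E.
have {}vE : cong (ev R v0) (ev R (lift a ++ d0 ++ lift b)).
  by apply: cong_map_word; rewrite vE /map_word !map_cat -!/(map_word _) !liftK d0E.
apply: cong_trans uE _; apply: cong_sym; move: vE.
by rewrite !ev_cat cd.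
Qed.

(** Bounds the kernel by every normal [N] that contains the fiber quotients, without constructing
    their normal closure. *)
Lemma pres_map_kernel g : pres_map g = 1 -> N g.
Proof.
elim/(@ev_ind _ R): g => w; rewrite pres_map_ev => /pres_classP w1.
by have := cong_word_eq w1 erefl (erefl (map_word [::])); rewrite ev_nil invg1 mulg1.
Qed.
End PresentedMorphism.

Section RetractMaps.
Context (S : solution) (x y : S).

Lemma lam_ret_class : lam (@sol_r (Ret S)) (ret_class x) (ret_class y) =
  ret_class (lam (@sol_r S) x y).
Proof. exact: (congr1 fst (ret_rE x y)). Qed.

Lemma rho_ret_class : rho (@sol_r (Ret S)) (ret_class y) (ret_class x) =
  ret_class (rho (@sol_r S) y x).
Proof. exact: (congr1 snd (ret_rE x y)). Qed.
End RetractMaps.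

(** * The rack operation of a solution *)

Section Rack.
Context (S : solution).
Local Notation r := (@sol_r S).
Local Notation lam := (lam r).
Local Notation rho := (rho r).
Let rP := solP S.

Definition lamV (x z : S) : S := projT1 (cid (lam_surj rP x z)).

Lemma lamVK x z : lam x (lamV x z) = z.
Proof. by rewrite /lamV; case: cid. Qed.

Lemma lamK x y : lamV x (lam x y) = y.
Proof. by apply: (lam_inj rP (x := x)); rewrite lamVK. Qed.

Definition sig (z x : S) : S := lam z (rho (lamV x z) x).

Lemma sig_lam x y : sig (lam x y) x = lam (lam x y) (rho y x).
Proof. by rewrite /sig lamK. Qed.

Lemma lam_sig a z x : lam a (sig z x) = sig (lam a z) (lam a x).
Proof.
rewrite -(lamVK x z); move: (lamV x z) => y.
have [e1 e2 _] := ybe3 rP a x y.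
by rewrite -e1 !sig_lam e2 e1; have [] := ybe3 rP a (lam x y) (rho y x).
Qed.

Lemma sig_sig z y x : sig z (sig y x) = sig (sig z y) (sig z x).
Proof.
rewrite -(lamVK x y); move: (lamV x y) => {}y.
have [b <-] := lam_surj rP x z; have {b} [z' <-] := lam_surj rP y b.
have [e1 e2 e3] := ybe3 rP x y z'.
(* Both sides equal [lam p (lam q1 (rho z' w1))]: the left one directly, the right one through
   [r (p, q1) = (t, q2)] and the third Yang-Baxter component. *)
set p := lam x y; set t := lam x (lam y z').
set w1 := rho y x; set q1 := lam w1 z'.
set w2 := rho (lam y z') x; set c := rho z' y; set q2 := lam w2 c.
have pq1 : lam p q1 = t by [].
have tq2 : lam t q2 = sig t p.
  have [h _ _] := ybe3 rP x (lam y z') c.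
  by rewrite /t /q2 /w2 h -sig_lam lam_sig.
have pq : lam p (lam q1 (rho z' w1)) = lam t (lam q2 (rho z' w1)).
  have [<- _ _] := ybe3 rP p q1 (rho z' w1).
  by rewrite pq1 /q1 e2.
have L : lam p (lam q1 (rho z' w1)) = sig t (sig p x).
  by rewrite /q1 -sig_lam lam_sig -/q1 pq1 /w1 -sig_lam.
have Rr : lam t (lam q2 (rho z' w1)) = sig (sig t p) (sig t x).
  by rewrite /w1 e3 /q2 -sig_lam lam_sig -/q2 tq2 /w2 -sig_lam.
by rewrite -L pq Rr.
Qed.

(** Since [r (x, lamV x z)] is [(z, rho (lamV x z) x)], bijectivity of [sig z] comes from that of
    [r] and [lam z]. *)
Lemma sig_inj z : injective (sig z).
Proof.
move=> x x' /(lam_inj rP) e.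
have /(bij_inj (sol_bij rP)) [] // : r (x, lamV x z) = r (x', lamV x' z).
by rewrite !r_lam_rho !lamVK e.
Qed.

Lemma sig_surj z u : exists x, sig z x = u.
Proof.
have [v <-] := lam_surj rP z u; have [s _ sK] := sol_bij rP.
have := sK (z, v); case: (s _) => x y; rewrite r_lam_rho => -[<- <-].
by exists x; rewrite sig_lam.
Qed.

(** [ret_eq] cancels under [lam x], so [lamV x z] and [lamV x z'] are equivalent and have the same
    [rho]. *)
Lemma ret_eq_sig z z' : ret_eq r z z' -> sig z = sig z'.
Proof.
move=> zz'; apply/funext => x.
have [_ ryy'] : ret_eq r (lamV x z) (lamV x z').
  by apply: (ret_eq_lam_inj rP (x := x)); rewrite !lamVK.
by rewrite /sig ryy'; case: zz' => ->.
Qed.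

Lemma derived_rel_sig x z : derived_rel [:: x; z] [:: z; sig z x].
Proof. by rewrite -(lamVK x z) sig_lam; apply: DerivedRel. Qed.

Lemma derived_relE u v : derived_rel u v ->
  exists x z, u = [:: x; z] /\ v = [:: z; sig z x].
Proof. by case=> x y; exists x, (lam x y); rewrite sig_lam. Qed.
End Rack.

(** * Structure group: the kernel over the retract is abelian *)

Section StructureGroup.
Context (S : solution).
Local Notation r := (@sol_r S).
Local Notation lam := (lam r).
Local Notation rho := (rho r).
Let rP := solP S.
Local Notation R := (@structure_rel S).
Local Notation gen := (gen R).

Lemma gen_structure x y : gen x * gen y = gen (lam x y) * gen (rho y x).
Proof. exact/gen_rel2/StructureRel. Qed.

Definition ret_diff : set (structure_group S) :=
  [set d | exists x y, ret_eq r x y /\ d = gen x * (gen y)^-1].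

(** The relations for [z x] and [z y] end in the same letter because [rho x = rho y]; it cancels in
    the quotient. *)
Lemma conj_diffV x y z : ret_eq r x y ->
  (gen x * (gen y)^-1) ^ (gen z)^-1 = gen (lam z x) * (gen (lam z y))^-1.
Proof.
move=> [_ rxy]; apply: (conj_div (c := gen (rho x z))).
  exact: gen_structure.
by rewrite gen_structure rxy.
Qed.

Lemma ret_diff_conj d g : ret_diff d -> ret_diff (d ^ g).
Proof.
apply: gen_conj_closed => {}d z [x [y [xy ->]]]; last first.
  rewrite conj_diffV //; exists (lam z x), (lam z y); split=> //.
  exact: ret_eq_lam.
have [x' x'E] := lam_surj rP z x; have [y' y'E] := lam_surj rP z y.
have xy' : ret_eq r x' y' by apply: (ret_eq_lam_inj rP (x := z)); rewrite x'E y'E.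
by exists x', y'; rewrite -x'E -y'E -conj_diffV // conjgKV.
Qed.

(* If [z] and [z'] are equivalent then [lam z = lam z'], so by [conj_diffV] the
   generators [z] and [z'] act in the same way on [ret_diff] by conjugation. *)
Lemma ret_diff_commute z z' : ret_eq r z z' ->
  centralizer ret_diff (gen z * (gen z')^-1).
Proof.
move=> zz'.
have [_ NJ] := centralizer_normal ret_diff_conj.
suff /(NJ _ (gen z')^-1) : centralizer ret_diff ((gen z')^-1 * gen z).
  by rewrite /conjg invgK mulgA mulVKg.
move=> _ [x [y [xy ->]]]; apply: conjV_eq_commute.
by rewrite !conj_diffV //; case: zz' => ->.
Qed.

Lemma structure_ret u v : R u v ->
  @structure_rel (Ret S) (map (@ret_class S) u) (map (@ret_class S) v).
Proof.
case=> x y; have := @StructureRel (Ret S) (ret_class x) (ret_class y).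
by rewrite lam_ret_class rho_ret_class.
Qed.

Lemma structure_ret_lift u v : @structure_rel (Ret S) u v ->
  exists u0 v0, [/\ R u0 v0, map (@ret_class S) u0 = u & map (@ret_class S) v0 = v].
Proof.
case; elim/ret_ind=> x; elim/ret_ind=> y.
exists [:: x; y], [:: lam x y; rho y x]; split=> //.
by rewrite lam_ret_class rho_ret_class.
Qed.

Definition ret_structure_map : structure_group S -> structure_group (Ret S) :=
  pres_map (@structure_rel (Ret S)) (@ret_class S).

Lemma ret_structure_mapM : {morph ret_structure_map : x y / x * y}.
Proof. exact: pres_mapM structure_ret. Qed.

Lemma structure_ret_kernel_abelian (g h : structure_group S) :
    ret_structure_map g = 1 ->
    ret_structure_map h = 1 ->
  commute g h.
Proof.
pose K := [set k | ret_structure_map k = 1].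
have kerN N := pres_map_kernel structure_ret (@ret_reprK S) structure_ret_lift (N := N).
have fM := ret_structure_mapM.
have KJ k a : K k -> K (k ^ a).
  by rewrite /K /= /conjg !fM => ->; rewrite mul1g -fM mulVg (morph_one fM).
(* First use, with the centralizer of the whole kernel [K]: it remains to commute [h] in [K] with a
   single quotient from [ret_diff]. *)
move=> gK; move: g gK h; apply: (kerN _); first exact: (centralizer_normal KJ).
move=> x y /ret_classP xy h hK; apply: commute_sym.
(* Second use, with the centralizer of [ret_diff], which contains [ret_diff] itself. *)
have {}hK : centralizer ret_diff h.
  apply: kerN hK; first exact: centralizer_normal ret_diff_conj.
  by move=> z z' /ret_classP; apply: ret_diff_commute.
by apply: hK; exists x, y.
Qed.
End StructureGroup.

(** * Derived group: the kernel over the retract is central *)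

Section DerivedGroup.
Context (S : solution).
Local Notation r := (@sol_r S).
Local Notation R := (@derived_rel S).
Local Notation gen := (gen R).

Lemma gen_sig x z : gen (sig z x) = gen x ^ gen z.
Proof.
by rewrite /conjg (gen_rel2 (derived_rel_sig x z)) mulKg.
Qed.

Lemma derived_ret_central x y : ret_eq r x y ->
  centralizer setT (gen x * (gen y)^-1).
Proof.
move=> xy g _; apply: commute_gen => z; apply: commute_sym; apply/commgP.
by rewrite -conjg_fix conjgM -gen_sig (ret_eq_sig xy) gen_sig conjgK.
Qed.

Lemma derived_ret u v : R u v ->
  @derived_rel (Ret S) (map (@ret_class S) u) (map (@ret_class S) v).
Proof.
case=> x y; have := @DerivedRel (Ret S) (ret_class x) (ret_class y).
by rewrite lam_ret_class rho_ret_class lam_ret_class.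
Qed.

Lemma derived_ret_lift u v : @derived_rel (Ret S) u v ->
  exists u0 v0, [/\ R u0 v0, map (@ret_class S) u0 = u & map (@ret_class S) v0 = v].
Proof.
case; elim/ret_ind=> x; elim/ret_ind=> y.
exists [:: x; lam r x y], [:: lam r x y; lam r (lam r x y) (rho r y x)]; split.
- exact: (DerivedRel x y).
- by rewrite /= lam_ret_class.
- by rewrite /= lam_ret_class rho_ret_class lam_ret_class.
Qed.

Definition ret_derived_map : derived_group S -> derived_group (Ret S) :=
  pres_map (@derived_rel (Ret S)) (@ret_class S).

Lemma ret_derived_mapM : {morph ret_derived_map : x y / x * y}.
Proof. exact: pres_mapM derived_ret. Qed.

Lemma derived_ret_kernel_central (g h : derived_group S) :
  ret_derived_map g = 1 -> commute g h.
Proof.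
move=> gK; suff : centralizer setT g by apply.
apply: (pres_map_kernel derived_ret (@ret_reprK S) derived_ret_lift) gK.
  by apply: centralizer_normal.
by move=> x y /ret_classP; apply: derived_ret_central.
Qed.
End DerivedGroup.

(** * Malcev words in nilpotent groups *)

Section MalcevWords.
Context {X : Type}.

(** Built on plain words, so that one pair can be evaluated both in the monoid and in the group. *)
Fixpoint malcev_words (u : nat -> seq X) (s t : seq X) (k : nat) : seq X * seq X :=
  if k is k'.+1 then
    let: (x, y) := malcev_words u s t k' in (x ++ u k ++ y, y ++ u k ++ x)
  else (s, t).

Lemma malcev_words_morph (M : monoidType) (f : seq X -> M) u s t k :
    (forall v w, f (v ++ w) = f v * f w) ->
  malcev_pair (fun i => f (u i)) (f s) (f t) k =
  (f (malcev_words u s t k).1, f (malcev_words u s t k).2).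
Proof.
move=> fM; elim: k => //= k ->; case: malcev_words => x y /=.
by rewrite !fM !mulgA.
Qed.
End MalcevWords.

(** Each Malcev step thus moves the quotient [x / y] one term down the lower central series. *)
Lemma malcev_step_commg (G : groupType) (x y u : G) :
  x * u * y / (y * u * x) = [~ (x / y)^-1, (y * u)^-1].
Proof.
have -> : x = x / y * y by rewrite mulgVK.
move: (x / y) => z; rewrite mulgK /commg /conjg !invgK !invgM.
by rewrite !mulgA mulgK.
Qed.

Lemma malcev_lower_central (G : groupType) (s t : G) u k :
  let: (x, y) := malcev_pair u s t k in @lower_central_series G k (x / y).
Proof.
elim: k => //= k; case: malcev_pair => x y.
have [_ _ sV] := @lower_central_series_is_subgroup G k.
by move=> /sV xy; rewrite malcev_step_commg; apply: comm_subgroup_mem.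
Qed.

Lemma malcev_nilpotent (G : groupType) (s t : G) u n :
    @lower_central_series G n = [set 1] ->
  (malcev_pair u s t n).1 = (malcev_pair u s t n).2.
Proof.
move=> Gn; have := malcev_lower_central s t u n; rewrite Gn.
by case: malcev_pair => x y /= /divg1_eq.
Qed.

(** * Malcev words in the derived monoid *)

Section DerivedMonoid.
Context (S : solution).
Local Notation R := (@derived_rel S).
Local Notation "u =w v" := (word_eq R u v) (at level 70).

Definition act (w : seq S) (x : S) : S := foldl (fun y z => sig z y) x w.

Lemma act_cat u v : act (u ++ v) = act v \o act u.
Proof. by apply/funext => x; rewrite /act foldl_cat. Qed.

Lemma act_act z w x : act (map (act z) w) (act z x) = act z (act w x).
Proof.
elim: z w x => [|y z IH] w x /=; first by rewrite map_id.
rewrite (map_comp (act z) (sig y)) IH; congr (act z _).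
by elim: w x => //= a w IHw x; rewrite -sig_sig IHw.
Qed.

(** By [act_act] the left side is the conjugate of [act w] by [act z], a bijection equal to
    [act w]. *)
Lemma act_map z w : act z = act w -> act (map (act z) w) = act w.
Proof.
move=> zw; apply/funext => x.
have [y <-] : exists y, act z y = x.
  elim: z x {zw} => [|a z IH] x; first by exists x.
  by have [y <-] := IH x; have [v <-] := sig_surj a y; exists v.
by rewrite act_act zw.
Qed.

Lemma word_swap u v : u ++ v =w v ++ map (act v) u.
Proof.
elim: v u => [|z v IH] u /=; first by rewrite cats0 map_id; apply: word_eq_refl.
have swap1 : u ++ [:: z] =w z :: map (sig z) u.
  elim: u {IH} => [|x u IHu] /=; first exact: word_eq_refl.
  apply: word_eq_trans (word_eq_cat2l [:: x] IHu) _.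
  exact: (word_eq_rel [::] (map (sig z) u) (derived_rel_sig x z)).
rewrite -cat1s catA; apply: word_eq_trans (word_eq_cat2r v swap1) _.
rewrite (map_comp (act v) (sig z)).
exact: (word_eq_cat2l [:: z] (IH (map (sig z) u))).
Qed.

(** With s = [act x], moving x past itself gives x s(x); moving x past s(x) then gives s(x) s(x),
    since s(x) also acts as s. *)
Lemma word_square_act x : x ++ x =w map (act x) x ++ map (act x) x.
Proof.
apply: word_eq_trans (word_swap x x) _.
by have := word_swap x (map (act x) x); rewrite act_map.
Qed.

Lemma word_swap_twist x y u : act x = act y ->
  x ++ u ++ y =w x ++ y ++ map (act x) u /\ y ++ u ++ x =w y ++ x ++ map (act x) u.
Proof.
by move=> xy; split; apply: word_eq_cat2l; [rewrite xy|]; apply: word_swap.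
Qed.

Lemma word_palindrome x y : act x = act y -> x ++ y ++ y ++ x =w x ++ x ++ y ++ y.
Proof.
move=> xy; apply: word_eq_cat2l.
rewrite (catA y y x); apply: word_eq_trans (word_swap (y ++ y) x) _.
apply: word_eq_cat2l; rewrite map_cat xy.
exact/word_eq_sym/word_square_act.
Qed.

(** The swap applies [act x] twice to [x ++ x], and [word_square_act] undoes each application. *)
Lemma word_squares x y : act x = act y -> x ++ x ++ y ++ y =w y ++ y ++ x ++ x.
Proof.
move=> xy; have := word_swap (x ++ x) (y ++ y).
rewrite -!catA => /word_eq_trans; apply.
do 2 apply: word_eq_cat2l; rewrite map_cat act_cat -xy.
rewrite (map_comp (act x) (act x)); apply: word_eq_sym.
apply: word_eq_trans (word_square_act x) _.
have := word_square_act (map (act x) x).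
by rewrite act_map.
Qed.

Lemma word_malcev2 x y u v : act x = act y ->
  (x ++ u ++ y) ++ v ++ (y ++ u ++ x) =w (y ++ u ++ x) ++ v ++ (x ++ u ++ y).
Proof.
move=> xy; have [e1 e2] := word_swap_twist u xy.
set w := map (act x) u in e1 e2.
(* [X] and [Y] act alike, so a second swap moves [v] to the end; it remains that [X] and [Y]
   commute. *)
set X := x ++ y ++ w; set Y := y ++ x ++ w.
have XY : act X = act Y by rewrite /X /Y !act_cat xy.
(* The tail is the same for both orders of [x] and [y], as they act alike; only the palindromes
   remain to be compared. *)
have g a b : act a = act b ->
    (a ++ b ++ w) ++ b ++ a ++ w =w (a ++ b ++ b ++ a) ++ map (act (b ++ a)) w ++ w.
  move=> ab; rewrite -!catA; do 2 apply: word_eq_cat2l.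
  have := word_eq_cat2r w (word_swap w (b ++ a)).
  by rewrite -!catA.
have YX : Y ++ X =w X ++ Y.
  apply: word_eq_trans (g y x (esym xy)) _; apply: word_eq_sym.
  apply: word_eq_trans (g x y xy) _.
  rewrite !act_cat xy; apply: word_eq_cat2r.
  apply: word_eq_trans (word_palindrome xy) _; apply: word_eq_sym.
  apply: word_eq_trans (word_palindrome (esym xy)) _.
  exact: word_squares (esym xy).
have [f1 f2] := word_swap_twist v XY.
apply: word_eq_trans (word_eq_cat e1 (word_eq_cat2l v e2)) _.
apply: word_eq_trans f1 _; apply: word_eq_sym.
apply: word_eq_trans (word_eq_cat e2 (word_eq_cat2l v e1)) _.
apply: word_eq_trans f2 _.
by rewrite (catA Y X) (catA X Y); apply: word_eq_cat2r.
Qed.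

Definition sigV (z x : S) : S := projT1 (cid (sig_surj z x)).

Lemma sigVK z x : sig z (sigV z x) = x.
Proof. by rewrite /sigV; case: cid. Qed.

Lemma sigK z x : sigV z (sig z x) = x.
Proof. by apply: (@sig_inj _ z); rewrite sigVK. Qed.

Definition signed_act (w : seq (S * bool)) (x : S) : S :=
  foldl (fun y a => if a.2 then sig a.1 y else sigV a.1 y) x w.

Lemma signed_act_pos w : signed_act (pos_word w) = act w.
Proof. by apply/funext => x; elim: w x => //= z w IH x; rewrite IH. Qed.

(** The monoid may fail to be cancellative, so an equality in the group is used only through the
    action it forces. The relations are respected because [sig] is bijective and
    self-distributive. *)
Lemma signed_act_word_eq u v :
  word_eq (group_rel R) u v -> signed_act u = signed_act v.
Proof.
elim=> // [a c d b cd|a b c _ -> _ ->] //.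
suff cdE : signed_act c = signed_act d.
  apply/funext => x; rewrite /signed_act !foldl_cat; congr foldl.
  exact: (congr1 (@^~ _) cdE).
case: cd => [_ _ /derived_relE[x [z [-> ->]]]|x [|]]; last 2 first.
- by apply/funext => y /=; rewrite sigK.
- by apply/funext => y /=; rewrite sigVK.
by rewrite !signed_act_pos; apply/funext => y /=; rewrite sig_sig.
Qed.

Lemma derived_monoid_malcev n : @lower_central_series (derived_group S) n = [set 1] ->
  forall (s t : derived_monoid S) (u : nat -> derived_monoid S),
  (malcev_pair u s t n.+2).1 = (malcev_pair u s t n.+2).2.
Proof.
move=> nil_n s t u; pose f : seq S -> derived_monoid S := pres_class R.
have fM v w : f (v ++ w) = f v * f w by symmetry; apply: pres_mulE.
pose us i := pres_repr (u i); pose ss := pres_repr s; pose ts := pres_repr t.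
have -> : u = fun i => f (us i) by apply/funext => i; rewrite /f pres_reprK.
rewrite -(pres_reprK s) -(pres_reprK t) -/ss -/ts.
rewrite (malcev_words_morph us ss ts n.+2 fM).
pose g w : derived_group S := ev R (pos_word w).
have gM v w : g (v ++ w) = g v * g w by rewrite -ev_cat /pos_word -map_cat.
have := malcev_nilpotent (g ss) (g ts) (fun i => g (us i)) nil_n.
rewrite (malcev_words_morph us ss ts n gM) /=.
case: malcev_words => x y /= /pres_classP/signed_act_word_eq.
rewrite !signed_act_pos => xy.
(* This performs the Malcev steps [n.+1] and [n.+2] at once. *)
exact/pres_classP/word_malcev2.
Qed.
End DerivedMonoid.

(** * Induction on the level along the retracts *)

Lemma subsingleton_pres_commute (T : Type) (R : seq T -> seq T -> Prop) :
  (exists x : T, forall y, y = x) -> forall g h : pres_group R, commute g h.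
Proof.
move=> [x xP] g h; apply: commute_gen => y; apply: commute_sym.
by apply: commute_gen => z; rewrite (xP y) (xP z).
Qed.

(** At level 0 the group has one generator: it is abelian but not trivial, whence the extra 1 in the
    bound. *)
Lemma structure_group_solvable n (S : solution) :
    (exists x : iter n Ret S, forall y, y = x) ->
  @derived_series (structure_group S) n.+1 = [set 1].
Proof.
elim: n S => [|n IH] S.
  move=> SP; apply: comm_subgroup_triv => g h _ _.
  exact: subsingleton_pres_commute.
rewrite iterSr => /IH; apply: derived_series_abelian_kernel.
  exact: ret_structure_mapM.
exact: structure_ret_kernel_abelian.
Qed.

Lemma derived_group_nilpotent n (S : solution) :
    (exists x : iter n Ret S, forall y, y = x) ->
  @lower_central_series (derived_group S) n.+1 = [set 1].
Proof.
elim: n S => [|n IH] S.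
  move=> SP; apply: comm_subgroup_triv => g h _ _.
  exact: subsingleton_pres_commute.
rewrite iterSr => /IH; apply: lower_central_series_central_kernel.
  exact: ret_derived_mapM.
by move=> g h; apply: derived_ret_kernel_central.
Qed.

Theorem theorem4p15 (X : solution) (m : nat) (hX : multipermutation_level X m) :
  (exists2 d, solvable_of_length (structure_group X) d & d <= m.+1) /\
  (exists2 c, malcev_nilpotent_of_class (derived_monoid X) c & c <= m + 3) /\
  (exists2 c, nilpotent_of_class (derived_group X) c & c <= m.+1).
Proof.
have [Xm _] := hX; have nilX := derived_group_nilpotent Xm.
split; first exact/least_le/structure_group_solvable.
split; last exact: least_le.
(* Here [m + 3] is [m.+1] from the group plus the two steps on words. *)
by rewrite addn3; apply: least_le; apply: derived_monoid_malcev.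
Qed.
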